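(* Let $0<p<\infty$, $0<q\le\infty$. If $\max\{p,q\}>2$, then there exist $\delta=\delta(p,q)>0$ and a constant $C=C(p,q)$ such that for each $N\in\mathbb N$ one can find a family of symmetrically distributed independent functions $\{f_k\}_{k=1}^N\subset L_{p,q}$, $\|f_k\|_{p,q}=1$, $k=1,\dots,N$, such that for $n\ge N^{1-\delta}$ we have $$d_n(\{f_1,\dots,f_N\},L_{p,q})\le CN^{-\delta}.$$
   Context: Functions are real-valued and Lebesgue measurable on $[0,1]$; independence is with respect to Lebesgue measure $m$. A function $f$ is symmetrically distributed if $f$ and $-f$ are identically distributed. The (quasi-Banach) Lorentz space $L_{p,q}$ consists of all measurable $x$ on $[0,1]$ with $\|x\|_{p,q}:=\big(\int_0^1x^*(t)^q\,d(t^{q/p})\big)^{1/q}<\infty$ for $q<\infty$, and $\|x\|_{p,\infty}:=\sup_{0<t\le1}t^{1/p}x^*(t)<\infty$ for $q=\infty$, where $x^*(t):=\inf\{\tau\ge0:\ m\{s\in[0,1]:|x(s)|>\tau\}<t\}$, $0<t\le1$, is the non-increasing left-continuous rearrangement of $|x|$. Kolmogorov width in a quasi-normed space $X$: $d_n(K,X):=\inf_{\dim V\le n}\sup_{x\in K}\inf_{v\in V}\|x-v\|_X$, the infimum over linear subspaces $V\subset X$ of dimension at most $n$. *)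

(* Defs.v *)
From HB Require Import structures.
From mathcomp Require Import all_boot all_order all_algebra.
From mathcomp Require Import all_classical all_reals all_analysis.
Import Order.TTheory GRing.Theory Num.Theory.
Import numFieldNormedType.Exports.

Set Implicit Arguments.
Unset Strict Implicit.
Unset Printing Implicit Defensive.

Local Open Scope classical_set_scope.
Local Open Scope ring_scope.

(* The real line with the Lebesgue sigma-algebra, i.e. the Caratheodory sigma-algebra of
   the outer measure induced by the length of intervals: the domain of
   completed_lebesgue_measure.  The bare type R carries the Borel sets. *)
Definition lebesgueType (R : realType) : measurableType _ :=
  caratheodory_type ((wlength (@idfun R))^*)%mu.

Section unit_interval.
Context {R : realType}.
Implicit Types f g : R -> R.

Definition m01 (A : set R) : \bar R :=
  completed_lebesgue_measure (`[0, 1] `&` A).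

(* Functions on [0, 1] are represented by total functions on R; everything
   below depends only on their values on [0, 1]. *)
Definition lebesgue_measurable_fun f :=
  measurable_fun (`[0, 1] : set (lebesgueType R)) (f : lebesgueType R -> R).

Definition identically_distributed f g :=
  forall B : set R, measurable B -> m01 (f @^-1` B) = m01 (g @^-1` B).

Definition symmetrically_distributed f := identically_distributed f (\- f).

Definition mutually_independent (N : nat) (f : 'I_N -> R -> R) :=
  forall (J : {set 'I_N}) (B : 'I_N -> set R),
    (forall k, measurable (B k)) ->
    m01 (\bigcap_(k in [set` J]) f k @^-1` B k) =
    (\prod_(k in J) m01 (f k @^-1` B k))%E.

Definition rearrangement f (t : R) : R :=
  inf [set tau : R | 0 <= tau /\ (m01 [set s | (tau < `|f s|)%R] < t%:E)%E].

End unit_interval.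

(* The function t |-> t ^ s for t >= 0, extended by its value at 0 to t < 0.
   The absolute value makes it nondecreasing for every s; only s > 0 is used. *)
Definition pow_cumulative {R : realType} (s t : R) : R :=
  (Num.max t 0) `^ `|s|.

Section pow_cumulative.
Context {R : realType}.
Variable s : R.

Let pow_nd : nondecreasing (@pow_cumulative R s).
Proof.
move=> x y xy; have max_ge0 (z : R) : 0 <= Num.max z 0 by rewrite le_max lexx orbT.
by apply: ge0_ler_powR; rewrite ?nnegrE// ge_max max_ge0 le_max xy.
Qed.

Let pow_rc : right_continuous (@pow_cumulative R s).
Proof.
have [s0|s0] := eqVneq s 0.
  have -> : @pow_cumulative R s = cst 1.
    by apply/funext => t; rewrite /pow_cumulative s0 normr0 powRr0.
  by move=> x; exact: cvg_cst.
move=> x; have [x0|x0|x0] := ltgtP x 0.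
- rewrite {2}/pow_cumulative max_r ?(ltW x0)// powR0 ?normr_eq0//.
  apply: cvg_near_cst; near=> y.
  rewrite /pow_cumulative max_r ?powR0 ?normr_eq0//.
  by apply/ltW; near: y; exact: nbhs_right_lt.
- apply: cvg_within_filter.
  have -> : pow_cumulative s x = expR (`|s| * ln x).
    by rewrite /pow_cumulative max_l ?(ltW x0)// /powR gt_eqF.
  suff : (fun y => expR (`|s| * ln y)) @ x --> expR (`|s| * ln x).
    apply: cvg_trans; apply: near_eq_cvg; near=> y.
    have y0 : 0 < y by near: y; exact: lt_nbhsr.
    by rewrite /pow_cumulative max_l ?(ltW y0)// /powR gt_eqF.
  apply: continuous_cvg; first exact: continuous_expR.
  by apply: cvgMl_tmp; exact: continuous_ln.
- rewrite x0 {2}/pow_cumulative maxxx powR0 ?normr_eq0//.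
  apply: (@cvg_trans _ ((fun y : R => y `^ `|s|) @ 0^'+)); last first.
    by apply: (@powR_cvg0 R `|s|); rewrite normr_gt0.
  apply: near_eq_cvg; near=> y.
  by rewrite /pow_cumulative max_l//; near: y; exact: nbhs_right_ge.
Unshelve. all: by end_near. Qed.

HB.instance Definition _ :=
  isCumulative.Build R _ R (@pow_cumulative R s) pow_nd pow_rc.
End pow_cumulative.

Section lorentz.
Context {R : realType}.
Local Open Scope ereal_scope.

(* The measure d(t^(q/p)) is a Lebesgue-Stieltjes measure.  The value at
   q = -oo is irrelevant. *)
Definition lorentz_norm (p : R) (q : \bar R) (x : R -> R) : \bar R :=
  match q with
  | r%:E => (\int[lebesgue_stieltjes_measure (pow_cumulative (r / p))]_(t in `]0%R, 1%R])
               (rearrangement x t `^ r)%:E) `^ r^-1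
  | +oo => ereal_sup [set (t `^ p^-1 * rearrangement x t)%:E | t in `]0%R, 1%R]]
  | -oo => 0
  end.

Definition lorentz_space (p : R) (q : \bar R) : set (R -> R) :=
  [set x | lebesgue_measurable_fun x /\ lorentz_norm p q x < +oo].

End lorentz.

Section width.
Context {R : realType} {E : lmodType R}.

Definition is_subspace (V : set E) :=
  V 0 /\ forall (a : R) (u v : E), V u -> V v -> V (a *: u + v).

(* Elements at distance 0 are identified (in a function space, functions that
   agree almost everywhere), so this is the dimension of the image of V in the
   quotient of E by the null vectors of nrm. *)
Definition dim_le (nrm : E -> \bar R) (V : set E) (n : nat) :=
  exists e : 'I_n -> E, (forall i, V (e i)) /\
    forall u, V u -> exists c : 'I_n -> R, nrm (u - \sum_(i < n) c i *: e i) = 0%E.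

Definition kolmogorov_width (nrm : E -> \bar R) (X K : set E) (n : nat) : \bar R :=
  ereal_inf
    [set ereal_sup [set ereal_inf [set nrm (x - v) | v in V] | x in K]
    | V in [set V : set E | [/\ V `<=` X, is_subspace V & dim_le nrm V n]]].

End width.

(* Main.v *)
Require Import Defs.
From mathcomp Require Import all_boot all_order all_algebra.
From mathcomp Require Import all_field.
From mathcomp Require Import all_classical all_reals all_analysis.
From mathcomp Require Import measurable_realfun.
From mathcomp Require Import ring lra.
Import Order.TTheory GRing.Theory Num.Theory.
Import numFieldNormedType.Exports.

Local Open Scope classical_set_scope.
Local Open Scope ring_scope.

Set Implicit Arguments.
Unset Strict Implicit.
Unset Printing Implicit Defensive.

(** The f_k take the values 0 and +-a_k on independent supports of measure mu_k, with
    a_k = mu_k ^ (-1/p). For a matrix G of rank r with unit diagonal and off-diagonal entries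
    of size at most eps, the functions sum_j G_kj f_j span a space of dimension at most r and
    f_k differs from the k-th of them by at most eps * sum_j |f_j| pointwise. Incidences of
    the graphs of quadratic polynomials over a field with Q = 2^i elements give such a G with
    r = Q^2 and eps = 2/Q, for up to Q^3 indices. It remains to choose mu so that
    sum_j |f_j| has norm O(N^theta) with theta < 1/2: for p > 2 equal and tiny mu_k make
    theta = 1/p possible, and for q > 2 geometrically decreasing mu_k give theta = 1/q. *)

(** * Counting probability on finite sample spaces, realized on the unit interval *)

Definition pr (R : realType) (Omega : finType) (P : pred Omega) : R :=
  #|P|%:R / #|Omega|%:R.
Arguments pr R {Omega} P.

(** The interval [0, 1) is cut into half-open cells of equal length, one for each element of
    [Omega], and [X] sends each cell to its element. Probabilistic statements on [0, 1] thereby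
    become counting in [Omega]. *)
Lemma uniform_map (R : realType) (Omega : finType) (w0 : Omega) :
  exists X : R -> Omega, forall P : pred Omega,
    measurable (`[0, 1] `&` [set s | P (X s)] : set (lebesgueType R)) /\
    m01 [set s | P (X s)] = (pr R P)%:E.
Proof.
have W0 : (0 < #|Omega|%:R :> R) by rewrite ltr0n; apply/card_gt0P; exists w0.
exists (fun s => nth w0 (enum Omega) (Num.trunc (s * #|Omega|%:R))) => P.
pose cell (i : 'I_#|Omega|) : set (lebesgueType R) :=
  `[i%:R / #|Omega|%:R, i.+1%:R / #|Omega|%:R[%classic.
have mcell i : measurable (cell i).
  by apply: sub_caratheodory; exact: measurable_itv.
have cellP i (s : R) : cell i s <-> i%:R <= s * #|Omega|%:R < i.+1%:R.
  by rewrite /cell /= in_itv /= ler_pdivrMr // ltr_pdivlMr.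
have cell_trunc i (s : R) : cell i s -> Num.trunc (s * #|Omega|%:R) = i.
  by move=> /cellP; exact: truncn_def.
have mucell i : completed_lebesgue_measure (cell i) = (#|Omega|%:R^-1)%:E.
  transitivity (lebesgue_measure (`[i%:R / #|Omega|%:R, i.+1%:R / #|Omega|%:R[ : set R)).
    by [].
  rewrite lebesgue_measure_itv /= lte_fin ltr_pM2r ?invr_gt0 // ltr_nat ltnSn.
  by rewrite -EFinB -mulrBl -natrB // subSnn mul1r.
pose A : set (lebesgueType R) := \big[setU/set0]_(i | P (enum_val i)) cell i.
have mA : measurable A by apply: bigsetU_measurable => i _.
(* The endpoint 1 lies in no cell: its index is [#|Omega|], where [nth] returns the default [w0]. It
   is split off as a null set. *)
pose B : set (lebesgueType R) :=
  [set s : R | s = 1 /\ P (nth w0 (enum Omega) (Num.trunc (s * #|Omega|%:R)))].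
have m1 : measurable ([set (1 : R)] : set (lebesgueType R)).
  by apply: sub_caratheodory; exact: measurable_set1.
have m1_0 : completed_lebesgue_measure [set (1 : R)] = 0.
  exact: (@lebesgue_measure_set1 R 1).
have [mB B0] : measurable B /\ completed_lebesgue_measure B = 0.
  have [h|h] := boolP (P (nth w0 (enum Omega) (Num.trunc (1 * #|Omega|%:R : R)))).
    suff -> : B = [set (1 : R)] by [].
    by apply/seteqP; split=> s /= [] // ->; split.
  suff -> : B = set0 by rewrite measure0; split; first exact: measurable0.
  by apply/seteqP; split=> s //= [->]; rewrite (negbTE h).
have AB : `[0, 1] `&` [set s | P (nth w0 (enum Omega) (Num.trunc (s * #|Omega|%:R)))]
    = A `|` B.
  have enumE (i : 'I_#|Omega|) : nth w0 (enum Omega) i = enum_val i.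
    by rewrite (enum_val_nth w0).
  apply/seteqP; split=> s /=.
    rewrite in_itv /= => -[/andP[s0 s1] Ps].
    move: s1; rewrite le_eqVlt => /orP[/eqP s1|s1]; first by right.
    left; rewrite /A -bigcup_seq_cond.
    have ht := truncn_itv (mulr_ge0 s0 (ltW W0)).
    have iW : (Num.trunc (s * #|Omega|%:R) < #|Omega|)%N.
      by rewrite truncn_lt_nat ?mulr_ge0 // ?ltW // gtr_pMl.
    exists (Ordinal iW); first by rewrite /= mem_index_enum -enumE.
    by apply/cellP.
  case; last first.
    by move=> [-> h]; rewrite in_itv /= ler01 lexx.
  rewrite /A -bigcup_seq_cond => -[i /andP[_ Pi] si].
  rewrite (cell_trunc _ _ si) enumE; split=> //.
  move/cellP: si => /andP[is1 is2]; rewrite in_itv /=; apply/andP; split.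
    by rewrite -(pmulr_lge0 _ W0) (le_trans _ is1).
  rewrite -(ler_pM2r W0) mul1r (le_trans (ltW is2)) // ler_nat.
  exact: ltn_ord.
split; first by rewrite AB; exact: measurableU.
rewrite /m01 AB measureU0 // /A measure_bigsetU_ord_cond //; last first.
  move=> i j _ _ [s [/cell_trunc si /cell_trunc sj]]; apply: val_inj.
  exact: etrans (esym si) sj.
transitivity (\sum_(i < #|Omega| | P (enum_val i)) (#|Omega|%:R^-1 : R)%:E)%E.
  by apply: eq_bigr => i _; exact: mucell.
rewrite sumEFin (sumr_const [pred i : 'I_#|Omega| | P (enum_val i)]).
suff <- : #|P| = #|[pred i : 'I_#|Omega| | P (enum_val i)]|.
  by rewrite /pr mulr_natl.
rewrite -!sum1_card (reindex _ (onW_bij _ (@enum_val_bij Omega))).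
exact: eq_bigl.
Qed.

Section pr.
Variables (R : realType) (Omega : finType).
Implicit Types P Q : pred Omega.

Lemma eq_pr P Q : P =1 Q -> pr R P = pr R Q.
Proof. by move=> PQ; rewrite /pr (eq_card PQ). Qed.

Lemma le_pr P Q : (forall w, P w -> Q w) -> pr R P <= pr R Q.
Proof.
move=> PQ; rewrite ler_wpM2r ?invr_ge0 ?ler0n // ler_nat.
by apply: subset_leq_card; apply/fintype.subsetP.
Qed.

Lemma pr_pred0 P : (forall w, ~~ P w) -> pr R P = 0.
Proof.
by move=> P0; rewrite /pr eq_card0 ?mul0r // => w; apply: negbTE (P0 w).
Qed.

Lemma prT (w0 : Omega) : pr R (@predT Omega) = 1.
Proof.
by rewrite /pr divff // pnatr_eq0 -lt0n; apply/card_gt0P; exists w0.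
Qed.

(** The union bound, by exchanging the order of a double count. *)
Lemma pr_exists (I : finType) (J : pred I) (A : I -> pred Omega) P :
  (forall w, P w -> exists2 i, J i & A i w) ->
  pr R P <= \sum_(i | J i) pr R (A i).
Proof.
move=> PA; rewrite -mulr_suml ler_wpM2r ?invr_ge0 ?ler0n // -natr_sum ler_nat.
rewrite -sum1_card (eq_bigr (fun i => \sum_w (A i w : nat))%N); last first.
  by move=> i _; rewrite -sum1_card [LHS]big_mkcond.
rewrite exchange_big /= [leqLHS]big_mkcond; apply: leq_sum => w _.
case: ifP => // Pw; have [i Ji Aiw] := PA w Pw.
by rewrite (bigD1 i) //= Aiw.
Qed.

End pr.

(** * Independence of the coordinates of a uniform point in a finite power *)

Section product_space.
Variables (R : realType) (N : nat) (T : finType) (t0 : T).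
Implicit Types B : 'I_N -> pred T.

Lemma pr_forall B :
  pr R [pred w : {ffun 'I_N -> T} | [forall k, B k (w k)]] = \prod_k pr R (B k).
Proof.
rewrite /pr prodf_div -natr_prod; congr (_%:R / _).
  under [in RHS]eq_bigr do rewrite -sum1_card.
  rewrite bigA_distr_big_dep /= -sum1_card; apply: eq_big => w.
    by apply/forallP/familyP.
  by move=> _; rewrite big1.
by rewrite card_ffun prodr_const natrX.
Qed.

Lemma pr_forall_in (J : {set 'I_N}) B :
  pr R [pred w : {ffun 'I_N -> T} | [forall k in J, B k (w k)]] =
  \prod_(k in J) pr R (B k).
Proof.
(* Coordinates outside [J] carry the full event, of probability 1 because [t0] inhabits [T]. *)
pose B' k : pred T := if k \in J then B k else predT.
transitivity (pr R [pred w : {ffun 'I_N -> T} | [forall k, B' k (w k)]]).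
  apply: eq_pr => w /=; apply: eq_forallb => k.
  by rewrite /B'; case: ifP => //= _; rewrite implybT.
rewrite pr_forall [RHS]big_mkcond; apply: eq_bigr => k _.
by rewrite /B'; case: ifP => // _; exact: prT t0.
Qed.

Lemma pr_coord (k : 'I_N) (P : pred T) :
  pr R [pred w : {ffun 'I_N -> T} | P (w k)] = pr R P.
Proof.
transitivity (pr R [pred w : {ffun 'I_N -> T} | [forall j in [set k]%SET, P (w j)]]).
  apply: eq_pr => w /=; apply/idP/'forall_implyP => [Pw j|/(_ k)].
    by rewrite inE => /eqP ->.
  by apply; rewrite inE.
by rewrite (pr_forall_in _ (fun=> P)) big_set1.
Qed.

Lemma pr_coord2 (i j : 'I_N) (P Q : pred T) : i != j ->
  pr R [pred w : {ffun 'I_N -> T} | P (w i) && Q (w j)] = pr R P * pr R Q.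
Proof.
move=> ij; pose B k : pred T := if k == i then P else Q.
transitivity (pr R [pred w : {ffun 'I_N -> T} | [forall k in [set i; j]%SET, B k (w k)]]).
  apply: eq_pr => w /=; apply/andP/'forall_implyP => [[Pw Qw] k|h].
    by rewrite !inE /B; case: eqP => [->//|_ /= /eqP ->].
  have := h i; have := h j; rewrite !inE !eqxx orbT /B /= eqxx eq_sym (negbTE ij).
  by move=> Q1 P1; split; [exact: P1|exact: Q1].
rewrite (pr_forall_in _ B) big_setU1 ?inE //= big_set1 /B eqxx.
by rewrite eq_sym (negbTE ij).
Qed.

(** Preimages of Borel sets under the k-th function are events on the k-th coordinate alone, so the
    product formula for counting carries over to the measure. *)
Lemma independent_coords (X : R -> {ffun 'I_N -> T}) (u : 'I_N -> T -> R) :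
  (forall P : pred {ffun 'I_N -> T}, m01 [set s | P (X s)] = (pr R P)%:E) ->
  mutually_independent (fun k s => u k (X s k)).
Proof.
move=> XP J B mB.
pose A k : pred T := [pred t | `[<B k (u k t)>]].
transitivity (m01 [set s | [pred w : {ffun 'I_N -> T} | [forall k in J, A k (w k)]] (X s)]).
  congr m01; apply/seteqP; split=> s /= h.
    by apply/'forall_implyP => k kJ; apply/asboolP; exact: h.
  by move=> k kJ; move/'forall_implyP : h => /(_ k kJ) /asboolP.
rewrite XP pr_forall_in -prodEFin; apply: eq_bigr => k _.
rewrite -(pr_coord k) -XP; congr m01; apply/seteqP; split=> s /=.
  by move/asboolP.
by move=> h; apply/asboolP.
Qed.

End product_space.

(** * Pointwise bounds for the rearrangement *)

Section rearrangement_bounds.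
Variable R : realType.
Implicit Types (f : R -> R) (t a b : R).

Lemma rearrangement_ge0 f t : 0 <= rearrangement f t.
Proof.
rewrite /rearrangement; set S := [set _ | _].
(* The infimum of the empty set is 0 by convention. *)
have [->|S0] := eqVneq S set0; first by rewrite inf0.
by apply: lb_le_inf; [apply/set0P|move=> x []].
Qed.

Lemma rearrangement_le f t b : 0 <= b ->
  (m01 [set s | (b < `|f s|)%R] < t%:E)%E -> rearrangement f t <= b.
Proof. by move=> b0 bt; apply: ge_inf; [exists 0 => x []|split]. Qed.

(** The level [b] makes the set in the infimum nonempty; an empty set would have infimum 0 and the
    lower bound [a] could fail. *)
Lemma rearrangement_ge f t a b : 0 <= b ->
  (m01 [set s | (b < `|f s|)%R] < t%:E)%E ->
  (forall tau, 0 <= tau -> tau < a -> (t%:E <= m01 [set s | (tau < `|f s|)%R])%E) ->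
  a <= rearrangement f t.
Proof.
move=> b0 bt at_; apply: lb_le_inf; first by exists b.
move=> tau [tau0 taut]; rewrite leNgt; apply/negP => taua.
by have := lt_le_trans taut (at_ _ tau0 taua); rewrite ltxx.
Qed.

End rearrangement_bounds.

(** * Integration against d(t^s) *)

Section integral.
Variables (R : realType).
Local Open Scope ereal_scope.

(* Unlike [ge0_le_integral], this needs no measurability: the integral of a nonnegative
   function is a supremum over the simple functions below it. *)
Lemma ge0_le_integral_sup d (T : measurableType d) (mu : {measure set T -> \bar R})
    (D : set T) (f g : T -> \bar R) :
  (forall x, D x -> 0 <= f x) -> (forall x, D x -> f x <= g x) ->
  \int[mu]_(x in D) f x <= \int[mu]_(x in D) g x.
Proof.
move=> f0 fg.
have g0 x : D x -> 0 <= g x by move=> Dx; rewrite (le_trans (f0 x Dx)) ?fg.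
rewrite integral_mkcond [leRHS]integral_mkcond !ge0_integralTE.
- apply: ereal_sup_le => _ [h hf <-]; exists h => // x.
  apply: (le_trans (hf x)); rewrite /patch; case: ifP => // /set_mem.
  exact: fg.
- by move=> x; rewrite /patch; case: ifP => // /set_mem; exact: g0.
- by move=> x; rewrite /patch; case: ifP => // /set_mem; exact: f0.
Qed.

Lemma pow_cumulative_itv (s c : R) : (0 < s)%R -> (0 <= c)%R ->
  lebesgue_stieltjes_measure (pow_cumulative s) `]0%R, c] = (c `^ s)%:E.
Proof.
move=> s0 c0; rewrite /lebesgue_stieltjes_measure /measure_extension
  measurable_mu_extE /=; last first.
  exact: is_ocitv.
rewrite wlength_itv_bnd // /pow_cumulative max_l // maxxx gtr0_norm //.
by rewrite powR0 ?subr0 ?gt_eqF.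
Qed.

Lemma integral_pow_cumulative (s b c : R) : (0 < s)%R -> (0 <= b)%R -> (0 <= c <= 1)%R ->
  \int[lebesgue_stieltjes_measure (pow_cumulative s)]_(t in `]0%R, 1%R])
    (b * \1_(`]0%R, c] : set R) t)%:E = (b * c `^ s)%:E.
Proof.
move=> s0 b0 /andP[c0 c1]; under eq_integral do rewrite EFinM.
rewrite ge0_integralZl_EFin //; last first.
  apply/measurable_EFinP; apply: measurable_indic; exact: measurable_itv.
rewrite integral_indic; [|exact: measurable_itv..].
have -> : `]0%R, c] `&` `]0%R, 1%R] = `]0%R, c]%classic :> set R.
  apply/setIidPl => x /=; rewrite !in_itv /= => /andP[-> /le_trans]; exact.
by rewrite EFinM -(pow_cumulative_itv s0 c0).
Qed.

End integral.

(** The exponent 1/q with 1/oo = 0, so that the factor L^(1/q) in the norm bounds becomes 1 at q =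
    oo. *)
Definition einv (R : realType) (q : \bar R) : R := if q is r%:E then r^-1 else 0.
Arguments einv {R} q.

(** * Two-sided bounds for the Lorentz quasi-norm *)

Section lorentz_norm_bounds.
Variables (R : realType) (p : R) (q : \bar R).
Hypotheses (hp : 0 < p) (hq : (0 < q)%E).
Implicit Types f h : R -> R.

Lemma lorentz_norm_ge0 f : (0 <= lorentz_norm p q f)%E.
Proof.
case: q hq => [r _|_|//] /=; first exact: poweR_ge0.
apply: (@le_trans _ _ (1 `^ p^-1 * rearrangement f 1)%:E).
  by rewrite lee_fin mulr_ge0 ?powR_ge0 ?rearrangement_ge0.
by apply: ereal_sup_ubound; exists 1 => //=; rewrite in_itv /= ltr01 lexx.
Qed.

(** A function of size [a] on a set of measure [mu] has quasi-norm a mu^(1/p) whatever the second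
    exponent; this is the computation for a finite exponent r. *)
Lemma powR_rearrangement_unit (a mu : R) : 0 <= a -> 0 <= mu ->
  forall r, 0 < r -> (a `^ r * mu `^ (r / p)) `^ r^-1 = a * mu `^ p^-1.
Proof.
move=> a0 mu0 r r0; rewrite powRM ?powR_ge0 // -!powRrM divff ?gt_eqF //.
by rewrite powRr1 // mulrAC divff ?gt_eqF // mul1r.
Qed.

(** The rearrangement is at least [a] on (0, mu], so the quasi-norm dominates that of the step of
    height [a] there. *)
Lemma lorentz_norm_ge f (a b mu : R) : 0 <= a -> 0 <= b -> 0 < mu <= 1 ->
  m01 [set s | b < `|f s|] = 0%E ->
  (forall tau, 0 <= tau -> tau < a -> (mu%:E <= m01 [set s | (tau < `|f s|)%R])%E) ->
  ((a * mu `^ p^-1)%:E <= lorentz_norm p q f)%E.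
Proof.
move=> a0 b0 /andP[mu0 mu1] fb fa.
have ft t : 0 < t -> t <= mu -> a <= rearrangement f t.
  move=> t0 tmu; apply: (@rearrangement_ge _ f t a b) => //.
    by rewrite fb lte_fin.
  by move=> tau tau0 /(fa _ tau0); apply: le_trans; rewrite lee_fin.
case: q hq => [r|_|//]; last first.
  apply: le_trans (ereal_sup_ubound _); last first.
    by exists mu; [rewrite /= in_itv /= mu0|reflexivity].
  by rewrite lee_fin mulrC ler_wpM2l ?powR_ge0 // ft.
rewrite lte_fin => r0 /=.
rewrite -(powR_rearrangement_unit a0 (ltW mu0) r0) -poweR_EFin.
apply: gt0_ler_poweR; rewrite ?invr_ge0 ?(ltW r0) //.
- by rewrite in_itv /= lee_fin mulr_ge0 ?powR_ge0 //= leey.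
- rewrite in_itv /= leey andbT; apply: integral_ge0 => t _.
  by rewrite lee_fin powR_ge0.
rewrite -integral_pow_cumulative ?divr_gt0 ?powR_ge0 ?(ltW mu0) //.
apply: ge0_le_integral_sup => t /=; rewrite in_itv /= => /andP[t0 t1].
  by rewrite lee_fin mulr_ge0 ?powR_ge0 // indicE.
rewrite lee_fin indicE; have [|_] := boolP (t \in _); last first.
  by rewrite mulr0 powR_ge0.
rewrite inE /= in_itv /= => /andP[_ tmu]; rewrite mulr1.
by apply: ge0_ler_powR; rewrite ?nnegrE ?(ltW r0) ?rearrangement_ge0 ?ft.
Qed.

(* The distribution bounds say that h* is dominated by the step functions b_j on (0, c_j]. *)
Lemma lorentz_norm_le h (L : nat) (b c : nat -> R) (D : R) :
  (0 < L)%N -> b 0%N = 0 -> (forall j, 0 <= b j) -> (forall j, 0 <= c j <= 1) ->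
  m01 [set s | b L < `|h s|] = 0%E ->
  (forall j, (j < L)%N -> (m01 [set s | (b j < `|h s|)%R] <= (c j.+1)%:E)%E) ->
  0 <= D -> (forall j, (0 < j <= L)%N -> b j * c j `^ p^-1 <= D) ->
  (lorentz_norm p q h <= (L%:R `^ einv q * D)%:E)%E.
Proof.
move=> L0 b00 b0 c01 hL hj D0 hD.
have step t : 0 < t -> rearrangement h t = 0 \/
    exists2 j, (0 < j <= L)%N & rearrangement h t <= b j /\ t <= c j.
  move=> t0.
  (* Climb the levels while t <= c_k. At the first failure t > c_(k+1) the distribution bound gives
     h*(t) <= b_k, and t <= c_k is known from the level before; at k = 0 the value b_0 = 0 forces
     h*(t) = 0. If no failure occurs, level L applies. *)
  have H : forall k, (k <= L)%N -> (rearrangement h t = 0 \/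
      exists2 j, (0 < j <= L)%N & rearrangement h t <= b j /\ t <= c j) \/
      ((0 < k)%N -> t <= c k).
    elim=> [|k IH] kL; first by right.
    have [|tk] := IH (ltnW kL); first by left.
    have [ct|tc] := ltP (c k.+1) t; last by right.
    left; have hk : rearrangement h t <= b k.
      by apply: rearrangement_le => //; apply: le_lt_trans (hj _ kL) _; rewrite lte_fin.
    case: k {IH ct} kL tk hk => [|k] kL tk hk; last first.
      by right; exists k.+1; [rewrite (ltnW kL)|split => //; exact: tk].
    by left; apply/eqP; rewrite eq_le rearrangement_ge0 andbT -b00.
  have [//|tL] := H L (leqnn L).
  right; exists L; first by rewrite L0 leqnn.
  split; last exact: tL.
  by apply: rearrangement_le => //; rewrite hL lte_fin.
case: q hq => [r|_|//] /=; last first.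
  rewrite powRr0 mul1r; apply: ge_ereal_sup => x [t /=].
  rewrite in_itv /= => /andP[t0 t1] <-; rewrite lee_fin.
  have [->|[j jL [hb tc]]] := step t t0; first by rewrite mulr0.
  apply: le_trans (hD j jL); rewrite mulrC ler_pM ?rearrangement_ge0 ?powR_ge0 //.
  have /andP[cj0 _] := c01 j.
  by apply: ge0_ler_powR; rewrite ?nnegrE ?invr_ge0 ?(ltW hp) ?(ltW t0).
rewrite lte_fin => r0.
pose st (j : nat) (t : R) : R := b j `^ r * \1_(`]0%R, c j] : set R) t.
have st0 j t : 0 <= st j t by rewrite mulr_ge0 ?powR_ge0 // indicE.
pose nu := lebesgue_stieltjes_measure (@pow_cumulative R (r / p)).
have -> : L%:R `^ r^-1 * D = (L%:R * D `^ r) `^ r^-1.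
  by rewrite powRM ?powR_ge0 // -powRrM divff ?gt_eqF // powRr1.
rewrite -poweR_EFin.
apply: gt0_ler_poweR; rewrite ?invr_ge0 ?(ltW r0) //.
- rewrite in_itv /= leey andbT; apply: integral_ge0 => t _.
  by rewrite lee_fin powR_ge0.
- by rewrite in_itv /= lee_fin mulr_ge0 ?powR_ge0 //= leey.
(* The applicable step is bounded by the sum of all L steps, each of integral at most D^r; this
   costs the factor L^(1/r). *)
apply: (@le_trans _ _ (\int[nu]_(t in `]0%R, 1%R])
    \sum_(1 <= j < L.+1) (st j t)%:E)%E).
  apply: ge0_le_integral_sup => t /=; rewrite in_itv /= => /andP[t0 t1].
    by rewrite lee_fin powR_ge0.
  rewrite sumEFin lee_fin.
  have [->|[j jL [hb tc]]] := step t t0.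
    by rewrite powR0 ?gt_eqF //; apply: sumr_ge0 => j _; exact: st0.
  rewrite (big_rem j) /=; last by rewrite mem_index_iota ltnS.
  rewrite -[leLHS]addr0 lerD //; last by apply: sumr_ge0 => i _; exact: st0.
  rewrite /st indicE mem_set ?mulr1; last by rewrite /= in_itv /= t0.
  by apply: ge0_ler_powR; rewrite ?nnegrE ?(ltW r0) ?rearrangement_ge0.
rewrite ge0_integral_sum //; last 2 first.
- by move=> j; apply/measurable_EFinP; apply: measurable_funM.
- by move=> j t _; rewrite lee_fin.
rewrite (eq_bigr (fun j => (b j `^ r * c j `^ (r / p))%:E)); last first.
  by move=> j _; rewrite integral_pow_cumulative ?divr_gt0 ?powR_ge0.
rewrite sumEFin lee_fin.
have -> : L%:R * D `^ r = \sum_(1 <= j < L.+1) D `^ r.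
  by rewrite sumr_const_nat subSS subn0 mulr_natl.
apply: ler_sum_nat => j jL; rewrite mulrC [r / p]mulrC powRrM -powRM ?powR_ge0 //.
apply: ge0_ler_powR; rewrite ?nnegrE ?(ltW r0) ?mulr_ge0 ?powR_ge0 //.
by rewrite mulrC hD.
Qed.

End lorentz_norm_bounds.

(** * Large families of sets with small pairwise intersections *)

(* The graphs of the polynomials of degree at most 2 over the field with 2 ^ i elements. *)
Lemma nearly_disjoint_sets (i N : nat) : (0 < i)%N -> (N <= (2 ^ i) ^ 3)%N ->
  exists A : 'I_N -> {set 'I_((2 ^ i) ^ 2)},
    (forall k, #|A k| = 2 ^ i)%N /\
    (forall k j, k != j -> (#|A k :&: A j|%SET <= 2)%N).
Proof.
move=> i0 Nq; have [F _ cardF] := PrimePowerField (isT : prime 2) i0.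
have card2 : #|{: F * F}| = ((2 ^ i) ^ 2)%N by rewrite card_prod cardF.
have card3 : #|{: 3.-tuple F}| = ((2 ^ i) ^ 3)%N by rewrite card_tuple cardF.
have Nt : (N <= #|{: 3.-tuple F}|)%N by rewrite card3.
pose t (k : 'I_N) : 3.-tuple F := enum_val (widen_ord Nt k).
have t_inj : injective t by move=> k j /enum_val_inj [] /ord_inj.
pose P k : {poly F} := Poly (t k).
have P_inj k j : P k = P j -> k = j.
  move=> kj; apply: t_inj; apply: val_inj; apply: (@eq_from_nth _ 0).
    by rewrite !size_tuple.
  by move=> l _; rewrite -[LHS]coef_Poly -[RHS]coef_Poly -/(P k) -/(P j) kj.
pose g (z : F * F) : 'I_((2 ^ i) ^ 2) := cast_ord card2 (enum_rank z).
have g_inj : injective g by move=> z z' /cast_ord_inj /enum_rank_inj.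
pose c k x := g (x, (P k).[x]).
have c_inj k : injective (c k) by move=> x y /g_inj [].
exists (fun k => (c k @: [set: F])%SET); split=> [k|k j kj].
  by rewrite card_imset // cardsT cardF.
pose rs := enum [set x | root (P k - P j) x]%SET.
(* A common point of two graphs lies over a root of P_k - P_j, a nonzero polynomial of degree at
   most 2. *)
have sub : ((c k @: [set: F]) :&: (c j @: [set: F]) \subset c k @: [set x in rs])%SET.
  apply/fintype.subsetP => z; rewrite inE => /andP[/imsetP[x _ ->] /imsetP[y _]].
  move=> /g_inj [<- xy]; apply/imsetP; exists x => //.
  by rewrite inE mem_enum inE rootE !hornerE xy subrr.
apply: leq_trans (subset_leq_card sub) _; rewrite card_imset // -ltnS.
rewrite cardsE (card_uniqP (enum_uniq _)).
have Pkj : P k - P j != 0 by rewrite subr_eq0; apply: contraNneq kj => /P_inj ->.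
apply: leq_trans (max_poly_roots (rs := rs) Pkj _ (enum_uniq _)) _.
  by apply/allP => x; rewrite mem_enum inE.
apply: leq_trans (size_polyD _ _) _; rewrite size_polyN geq_max.
by rewrite !(leq_trans (size_Poly _)) ?size_tuple.
Qed.

(** * Upper bounds for the width *)

Lemma kolmogorov_width_le (R : realType) (E : lmodType R) (nrm : E -> \bar R)
    (X : set E) (N m n : nat) (f : 'I_N -> E) (e : 'I_m -> E)
    (G : 'I_N -> 'I_m -> R) (D : \bar R) :
  (m <= n)%N -> nrm 0 = 0%E -> (forall c : 'I_m -> R, X (\sum_i c i *: e i)) ->
  (forall k, nrm (f k - \sum_i G k i *: e i)%R <= D)%E ->
  (kolmogorov_width nrm X (range f) n <= D)%E.
Proof.
move=> mn nrm0 Xe hD.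
pose V : set E := [set \sum_i c i *: e i | c in [set: 'I_m -> R]].
have Vlin a c c' : a *: (\sum_i c i *: e i) + \sum_i c' i *: e i =
    \sum_i (a * c i + c' i) *: e i.
  by rewrite scaler_sumr -big_split; apply: eq_bigr => i _; rewrite scalerDl scalerA.
have V0 : V 0 by exists (fun=> 0) => //; rewrite big1 // => i _; rewrite scale0r.
have Ve i : V (e i).
  exists (fun j => (j == i)%:R) => //.
  rewrite (bigD1 i) //= eqxx scale1r big1 ?addr0 // => j /negbTE ->.
  by rewrite scale0r.
apply: (@le_trans _ _ (ereal_sup
    [set ereal_inf [set nrm (x - v)%R | v in V] | x in range f])).
  apply: ereal_inf_lbound; exists V => //=; split=> //.
  - by move=> _ [c _ <-].
  - split=> // a _ _ [c _ <-] [c' _ <-].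
    by exists (fun i => a * c i + c' i) => //; rewrite Vlin.
  (* [dim_le] asks for exactly n spanning vectors, so the m given ones are padded with zeros. *)
  - pose e' (i : nat) : E := oapp e 0 (insub i).
    have e'E (j : 'I_m) : e' j = e j by rewrite /e' valK.
    exists (fun i : 'I_n => e' i); split=> [i|_ [c _ <-]].
      by rewrite /e'; case: insub.
    pose c' (i : nat) : R := oapp c 0 (insub i).
    have c'E (j : 'I_m) : c' j = c j by rewrite /c' valK.
    exists (fun i : 'I_n => c' i).
    rewrite [X in (X - _)%R](_ : _ = \sum_(i < n) c' i *: e' i) ?subrr //.
    transitivity (\sum_(i < m) c' i *: e' i).
      by apply: eq_bigr => i _; rewrite c'E e'E.
    rewrite (big_ord_widen_cond n xpredT (fun i => c' i *: e' i)) //= big_mkcond.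
    apply: eq_bigr => i _; case: ifPn => // im.
    by rewrite /e' insubN //= scaler0.
apply: ge_ereal_sup => x [y [k _ <-] <-].
apply: le_trans (hD k); apply: ereal_inf_lbound.
by exists (\sum_i G k i *: e i) => //; exists (G k).
Qed.

(** Collects what the width bound uses. The first clause places the approximating span in the space
    directly, without a quasi-triangle inequality. The last one bounds the quasi-norm of sum_j |f_j|
    by [D], with homogeneity and monotonicity built in. *)
Definition spread_family (R : realType) (p : R) (q : \bar R) (N : nat)
    (f : 'I_N -> R -> R) (D : R) :=
  [/\ forall c : 'I_N -> R, lorentz_space p q (fun s => \sum_j c j * f j s),
      forall k, symmetrically_distributed (f k),
      mutually_independent f,
      forall k, lorentz_norm p q (f k) = 1%E &
      forall (eps : R) (g : R -> R), 0 <= eps ->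
        (forall s, `|g s| <= eps * \sum_j `|f j s|) ->
        (lorentz_norm p q g <= (eps * D)%:E)%E].

Section spread_family.
Variables (R : realType) (p : R) (q : \bar R) (N : nat) (f : 'I_N -> R -> R) (D : R).
Hypothesis hq : (0 < q)%E.
Hypothesis fD : spread_family p q f D.

Lemma spread_family_lorentz k : lorentz_space p q (f k).
Proof.
case: fD => /(_ (fun j => (j == k)%:R)) h _ _ _ _.
congr lorentz_space : h; apply/funext => s.
by rewrite (bigD1 k) //= eqxx mul1r big1 ?addr0 // => j /negbTE ->; rewrite mul0r.
Qed.

(** With e_x the sum of f_j / Q over the sets A_j containing x, the sum of e_x over x in A_k is
    sum_j G_kj f_j, where G_kj is the cardinality of the intersection of A_k and A_j divided by Q.
    This Gram matrix factors through m dimensions, has diagonal 1 and other entries at most 2 /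
    Q. *)
Lemma width_spread_family (Q m n : nat) (A : 'I_N -> {set 'I_m}) :
  (0 < Q)%N -> (m <= n)%N -> (forall k, #|A k| = Q) ->
  (forall k j, k != j -> (#|A k :&: A j|%SET <= 2)%N) ->
  (kolmogorov_width (lorentz_norm p q) (lorentz_space p q) (range f) n <=
    (2 / Q%:R * D)%:E)%E.
Proof.
move=> Q0 mn AQ A2; have QR : (0 : R) < Q%:R by rewrite ltr0n.
case: (fD) => fL _ _ _ fD'.
pose e (x : 'I_m) : R -> R := fun s => \sum_j ((x \in A j)%:R / Q%:R) * f j s.
have sumE (c : 'I_m -> R) s : (\sum_x c x *: e x) s =
    \sum_j ((\sum_x c x * (x \in A j)%:R) / Q%:R) * f j s.
  rewrite fct_sumE.
  under [RHS]eq_bigr do rewrite !mulr_suml.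
  rewrite [RHS]exchange_big /=; apply: eq_bigr => x _.
  rewrite -[LHS]/(c x * e x s) mulr_sumr; apply: eq_bigr => j _.
  by rewrite !mulrA.
apply: (@kolmogorov_width_le _ _ _ _ _ _ _ _ e (fun k x => (x \in A k)%:R) _ mn).
(* The domination clause with eps = 0 gives the zero function quasi-norm 0. *)
- apply/eqP; rewrite eq_le lorentz_norm_ge0 // andbT.
  rewrite -[leRHS]/((0 : R)%:E) -(mul0r D).
  by apply: fD' => // s; rewrite mul0r normr0.
- move=> c; have := fL (fun j => (\sum_x c x * (x \in A j)%:R) / Q%:R).
  by congr lorentz_space; apply/funext => s; rewrite sumE.
- move=> k; apply: fD' => [|s]; first by rewrite divr_ge0 // ltW.
  have AkE j : \sum_x (x \in A k)%:R * (x \in A j)%:R = #|A k :&: A j|%SET%:R :> R.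
    rewrite -sum1_card natr_sum [RHS]big_mkcond; apply: eq_bigr => x _.
    by rewrite inE -natrM mulnb; case: (_ && _).
  rewrite -[leLHS]/(`|f k s - (\sum_x (x \in A k)%:R *: e x) s|) sumE.
  rewrite (bigD1 k) //= AkE finset.setIid AQ divff ?gt_eqF // mul1r opprD addrA subrr sub0r.
  rewrite normrN mulr_sumr [leRHS](bigD1 k) //=.
  apply: (le_trans (ler_norm_sum _ _ _)); rewrite -[leLHS]add0r lerD //.
  apply: ler_sum => j jk; rewrite AkE normrM ler_wpM2r //.
  rewrite ger0_norm ?divr_ge0 ?(ltW QR) // ler_pM2r ?invr_gt0 // ler_nat.
  by rewrite A2 // eq_sym.
Qed.

End spread_family.

(** Squares of powers of 2 are powers of 4, so rounding [x] down to one of them loses a factor less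
    than 4. *)
Lemma dyadic_square (R : realType) (x : R) : 1 <= x ->
  exists i, ((2 ^ i) ^ 2)%N%:R <= x < 4 * ((2 ^ i) ^ 2)%N%:R.
Proof.
move=> x1; have x0 : 0 <= x by rewrite (le_trans ler01).
have t0 : (0 < Num.trunc x)%N by rewrite truncn_gt0.
have /andP[l1 l2] := trunc_log_bounds (isT : 1 < 4)%N t0.
exists (trunc_log 4 (Num.trunc x)).
have -> : ((2 ^ trunc_log 4 (Num.trunc x)) ^ 2 = 4 ^ trunc_log 4 (Num.trunc x))%N.
  by rewrite -!expnM mulnC expnM.
apply/andP; split; first by rewrite -truncn_ge_nat.
by rewrite -natrM -expnS -truncn_lt_nat.
Qed.

(** With Q^2 comparable to N^(1 - delta), the bound (2 / Q) C0 N^theta has order N^(theta - (1 -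
    delta) / 2), a negative power for small delta because theta < 1/2. *)
Lemma width_of_spread_families (R : realType) (p : R) (q : \bar R) (theta C0 : R) :
  (0 < q)%E -> 0 <= theta < 2^-1 -> 0 <= C0 ->
  (forall N, (0 < N)%N -> exists f : 'I_N -> R -> R,
     spread_family p q f (C0 * N%:R `^ theta)) ->
  exists delta C : R, 0 < delta /\
    forall N : nat, (0 < N)%N ->
      exists f : 'I_N -> R -> R,
        [/\ forall k, lorentz_space p q (f k),
            forall k, symmetrically_distributed (f k),
            mutually_independent f,
            forall k, lorentz_norm p q (f k) = 1%E &
            forall n : nat, N%:R `^ (1 - delta) <= n%:R ->
              (kolmogorov_width (lorentz_norm p q) (lorentz_space p q)
                 (range f) n <= (C * N%:R `^ (- delta))%:E)%E].
Proof.
move=> hq /andP[th0 th1] C00 H.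
(* This makes theta - (1 - delta) / 2 equal to - 5 delta / 2, and delta <= 1/6 leaves room for Q^3
   >= N. *)
pose delta : R := (2^-1 - theta) / 3.
have d0 : 0 < delta by rewrite /delta; lra.
have d1 : delta <= 1/6 by rewrite /delta; lra.
have [M ME] : exists M, M = (64 * 64)%N by eexists.
have MR : M%:R = 64 ^+ 2 :> R by rewrite ME natrM.
have M0 : (0 : R) < M%:R by rewrite MR exprn_gt0.
exists delta, (M%:R + 4 * C0); split=> // N N0.
have [f fD] := H N N0; exists f.
case: (fD) => _ f2 f3 f4 f5; split=> // [k|n Nn]; first exact: spread_family_lorentz fD k.
have NR : (0 : R) < N%:R by rewrite ltr0n.
have N1 : (1 : R) <= N%:R by rewrite ler1n.
(* For N < M the zero subspace suffices: the width is at most 1 <= M N^(- delta), whence the summand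
   M in the constant. *)
have [NM|MN] := ltnP N M.
  apply: (@kolmogorov_width_le _ _ _ _ _ 0 _ _ (fun=> 0) (fun _ _ => 0)) => //.
  - apply/eqP; rewrite eq_le lorentz_norm_ge0 // andbT.
    rewrite -[leRHS]/((0 : R)%:E) -(mul0r (C0 * N%:R `^ theta)).
    by apply: f5 => // s; rewrite mul0r normr0.
  - move=> c; rewrite big_ord0; case: fD => /(_ (fun=> 0)) h _ _ _ _.
    by congr lorentz_space : h; apply/funext => s; rewrite big1 // => j _; rewrite mul0r.
  - move=> k; rewrite big_ord0 subr0 f4 lee_fin.
    have : N%:R `^ (- 1) <= N%:R `^ (- delta) :> R by apply: ler_powR => //; lra.
    rewrite powR_inv1 // => h.
    have h' : M%:R^-1 <= N%:R `^ (- delta) :> R.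
      by apply: le_trans h; rewrite lef_pV2 ?posrE // ler_nat ltnW.
    rewrite -[leLHS](divff (lt0r_neq0 M0)); apply: le_trans (ler_wpM2l (ltW M0) h') _.
    by rewrite ler_wpM2r ?powR_ge0 // lerDl mulr_ge0.
set x : R := N%:R `^ (1 - delta) in Nn.
have x0 : 0 < x by rewrite powR_gt0.
have x1 : 1 <= x by rewrite -(powRr0 (N%:R : R)); apply: ler_powR => //; lra.
have [i /andP[qx xq]] := dyadic_square x1.
set Q := (2 ^ i)%N in qx xq.
have Q0 : (0 < Q)%N by rewrite expn_gt0.
have QR : (0 : R) < Q%:R by rewrite ltr0n.
(* From x < 4 Q^2 and delta <= 1/6 follows N^(5/2) <= x^3 <= 64 Q^6. Since N >= 64^2, the factor
   N^(1/2) absorbs the 64, leaving N^2 <= Q^6. *)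
have QN : (N <= Q ^ 3)%N.
  rewrite -(leq_exp2r _ _ (isT : 0 < 2)%N) -(@ler_nat R).
  have h1 : (N%:R `^ (5 / 6 * 3) : R) <= x ^+ 3.
    rewrite -powR_mulrn ?(ltW x0) // /x -powRrM; apply: ler_powR => //; lra.
  have h2 : x ^+ 3 <= (4 * (Q ^ 2)%:R) ^+ 3.
    by rewrite lerXn2r ?nnegrE ?mulr_ge0 // ltW.
  have h3 : (64 : R) <= N%:R `^ (1 / 2).
    have -> : (64 : R) = M%:R `^ (1 / 2).
      by rewrite MR -powR_mulrn // -powRrM mulrA mulr1 divff ?powRr1 ?pnatr_eq0.
    by apply: ge0_ler_powR; rewrite ?nnegrE // ler_nat.
  have h4 : (N%:R `^ (5 / 6 * 3) : R) = N%:R ^+ 2 * N%:R `^ (1 / 2).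
    rewrite -powR_mulrn // -powRD; last by rewrite gt_eqF // implybT.
    congr (_ `^ _); lra.
  have h5 : (0 : R) <= N%:R ^+ 2 by rewrite exprn_ge0.
  have -> : ((Q ^ 3) ^ 2)%:R = Q%:R ^+ 6 :> R by rewrite -expnM natrX.
  have h6 : (4 * (Q ^ 2)%:R) ^+ 3 = 64 * Q%:R ^+ 6 :> R by rewrite natrX; ring.
  rewrite natrX; move: h1 h2 (ler_wpM2l h5 h3); rewrite h4 h6; lra.
have i0 : (0 < i)%N.
  rewrite lt0n; apply: contraTneq QN => i0.
  by rewrite /Q i0 expn0 exp1n -ltnNge (leq_trans _ MN) // ME.
have [A [A1 A2]] := nearly_disjoint_sets i0 QN.
have Qn : (Q ^ 2 <= n)%N by rewrite -(ler_nat R) (le_trans qx).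
apply: le_trans (width_spread_family hq fD Q0 Qn A1 A2) _; rewrite lee_fin.
set y : R := N%:R `^ ((1 - delta) / 2).
have y0 : 0 < y by rewrite powR_gt0.
have yx : y ^+ 2 = x by rewrite -powR_mulrn ?(ltW y0) // -powRrM mulfVK.
(* The square root of x < 4 Q^2, with x = y^2; it bounds 2 / Q by 4 / y. *)
have yQ : y < 2 * Q%:R.
  rewrite -(ltr_pXn2r (_ : 0 < 2)%N) ?nnegrE ?(ltW y0) ?mulr_ge0 // yx.
  have -> : (2 * Q%:R) ^+ 2 = 4 * (Q ^ 2)%:R :> R by rewrite natrX; ring.
  by [].
have iQ : 2 / Q%:R <= 4 / y.
  rewrite ler_pdivrMr // mulrAC ler_pdivlMr //; lra.
have t0 : 0 <= C0 * N%:R `^ theta by rewrite mulr_ge0 // powR_ge0.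
apply: (le_trans (ler_wpM2r t0 iQ)).
have -> : 4 / y * (C0 * N%:R `^ theta) = (4 * C0) * (N%:R `^ (theta - (1 - delta) / 2)).
  rewrite powRB; last by apply/implyP => _; rewrite gt_eqF.
  rewrite -/y; ring.
have h : N%:R `^ (theta - (1 - delta) / 2) <= N%:R `^ (- delta) :> R.
  apply: ler_powR => //; rewrite /delta; lra.
apply: (le_trans (ler_wpM2l _ h)); first by lra.
by rewrite ler_wpM2r ?powR_ge0 //; lra.
Qed.

(** * Functions controlled by a finite probability space *)

Section pulled_back.
Variables (R : realType) (p : R) (q : \bar R) (Omega : finType) (w0 : Omega).
Variable X : R -> Omega.
Hypotheses (hp : 0 < p) (hq : (0 < q)%E).
Hypothesis XP : forall P : pred Omega,
  measurable (`[0, 1] `&` [set s | P (X s)] : set (lebesgueType R)) /\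
  m01 [set s | P (X s)] = (pr R P)%:E.

(** [m01] is an outer measure, hence monotone on all sets; this covers the level sets of an
    arbitrary dominated function. *)
Lemma le_m01 (A B : set R) : A `<=` B -> (m01 A <= m01 B)%E.
Proof.
move=> AB; apply: (@le_outer_measure _ _ ((wlength (@idfun R))^*)%mu).
exact: setIS.
Qed.

Lemma m01_pullback (A : set R) (P : pred Omega) :
  (forall s, A s <-> P (X s)) -> m01 A = (pr R P)%:E.
Proof. by move=> AP; rewrite -(XP P).2; congr m01; apply/seteqP; split=> s /AP. Qed.

Lemma pr_le1 (P : pred Omega) : pr R P <= 1.
Proof. by rewrite -(prT R w0); apply: le_pr. Qed.

(** A function of [X] takes finitely many values: its preimages are events, and it is dominated by a
    constant, a single step on (0, 1]. *)
Lemma lorentz_space_pullback (u : Omega -> R) : lorentz_space p q (u \o X).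
Proof.
split.
  move=> mD B mB.
  rewrite [X in measurable X](_ : _ =
    `[0, 1] `&` [set s | [pred w | `[<B (u w)>]] (X s)]); first exact: (XP _).1.
  by congr (_ `&` _); apply/seteqP; split=> s /asboolP.
pose b : R := \sum_w `|u w|.
have b0 : 0 <= b by apply: sumr_ge0.
have ub w : `|u w| <= b by rewrite /b (bigD1 w) //= lerDl sumr_ge0.
apply: (@le_lt_trans _ _ (1%:R `^ einv q * b)%:E); last by rewrite ltry.
apply: (@lorentz_norm_le _ _ _ hp hq _ 1 (fun j => if j is 0 then 0 else b) (fun=> 1)) => //.
- by case.
- by move=> _; rewrite ler01 lexx.
- rewrite (m01_pullback (P := pred0)) => [|s]; first by rewrite pr_pred0.
  by split=> //=; rewrite ltNge ub.
- case=> // _; rewrite (m01_pullback (P := [pred w | 0 < `|u w|])) => [|s]; last by [].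
  by rewrite lee_fin pr_le1.
- by case=> // j _; rewrite powR1 mulr1.
Qed.

(** Where |g| exceeds eps b_j, the function S o X exceeds b_j, so counting bounds for the tails of
    [S] become distribution bounds for [g] at the levels eps b_j. *)
Lemma lorentz_norm_tail (S : Omega -> R) (L : nat) (b c : nat -> R) (D eps : R) (g : R -> R) :
  (0 < L)%N -> b 0%N = 0 -> (forall j, 0 <= b j) -> (forall j, 0 <= c j <= 1) ->
  (forall w, S w <= b L) ->
  (forall j, (j < L)%N -> pr R [pred w | b j < S w] <= c j.+1) ->
  (forall j, (0 < j <= L)%N -> b j * c j `^ p^-1 <= D) -> 0 <= eps ->
  (forall s, `|g s| <= eps * S (X s)) ->
  (lorentz_norm p q g <= (eps * (L%:R `^ einv q * D))%:E)%E.
Proof.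
move=> L0 b0 bge c01 SL Sc bcD eps0 gS.
have D0 : 0 <= D by apply: le_trans (bcD L _); rewrite ?L0 ?leqnn // mulr_ge0 ?powR_ge0.
have gb j : (m01 [set s | eps * b j < `|g s|]%R <= (pr R [pred w | b j < S w]%R)%:E)%E.
  rewrite -(m01_pullback (A := [set s | b j < S (X s)])) //.
  apply: le_m01 => s /= /lt_le_trans /(_ (gS s)).
  by rewrite !ltNge; apply: contra => h; exact: ler_wpM2l.
rewrite mulrCA; apply: (@lorentz_norm_le _ _ _ hp hq _ L (fun j => eps * b j) c) => //.
- by rewrite b0 mulr0.
- by move=> j; rewrite mulr_ge0.
- apply/eqP; rewrite eq_le; apply/andP; split; last exact: measure_ge0.
  by apply: le_trans (gb L) _; rewrite pr_pred0 // => w /=; rewrite -leNgt.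
- by move=> j jL; apply: le_trans (gb j) _; rewrite lee_fin Sc.
- by rewrite mulr_ge0.
- by move=> j jL; rewrite -mulrA ler_wpM2l // bcD.
Qed.

End pulled_back.

(** * Independent three-valued functions of quasi-norm one *)

(* Independent functions equal to a_k, -a_k with probability mu_k / 2 each, and 0 otherwise,
   with mu_k = m k / Q and a_k = mu_k `^ (- 1 / p). *)
Section three_valued.
Variables (R : realType) (p : R) (q : \bar R) (N Q : nat) (m : 'I_N -> nat).
Hypotheses (hp : 0 < p) (hq : (0 < q)%E).
Hypotheses (Q0 : (0 < Q)%N) (mQ : forall k, (0 < m k <= Q)%N).

(** A coordinate is a sign bit together with a point of ['I_Q]; the first [m k] points form the
    support. *)
Let T := (bool * 'I_Q)%type.
Let t0 : T := (true, Ordinal Q0).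
Let mu k : R := (m k)%:R / Q%:R.
Let a k : R := (mu k `^ p^-1)^-1.
Let u k (t : T) : R := if (t.2 < m k)%N then (-1) ^+ t.1 * a k else 0.

Let mu01 k : 0 < mu k <= 1.
Proof.
have /andP[m0 m1] := mQ k.
by rewrite divr_gt0 ?ltr0n //= ler_pdivrMr ?ltr0n // mul1r ler_nat.
Qed.

Let a_gt0 k : 0 < a k.
Proof. by rewrite invr_gt0 powR_gt0 //; case/andP: (mu01 k). Qed.

Let normu k t : `|u k t| = a k * (t.2 < m k)%N%:R.
Proof.
rewrite /u; case: ifP => _; last by rewrite normr0 mulr0.
by rewrite normrM normrX normrN1 expr1n mul1r mulr1 gtr0_norm.
Qed.

Let pr_support k : pr R [pred t : T | (t.2 < m k)%N] = mu k.
Proof.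
have /andP[_ m1] := mQ k.
have -> : pr R [pred t : T | (t.2 < m k)%N] = (2 * m k)%:R / (2 * Q)%:R.
  rewrite /pr card_prod card_bool card_ord; congr (_%:R / _).
  rewrite -[in RHS]card_bool -[in RHS](card_ord (m k)) -card_prod.
  pose h (z : bool * 'I_(m k)) : T := (z.1, widen_ord m1 z.2).
  have h_inj : injective h by move=> [b i] [b' i'] [] -> /ord_inj ->.
  rewrite -[RHS](fintype.card_image h_inj); apply: eq_card => -[b i].
  apply/idP/fintype.imageP => [/= im|[[b' i'] _ [_ ->]]]; last exact: (ltn_ord i').
  by exists (b, Ordinal im) => //; congr pair; apply: val_inj.
by rewrite !natrM -mulf_div divff ?mul1r.
Qed.

(** Flipping the sign bit permutes [T] and negates [u k]. *)
Let pr_neg k (B : set R) : pr R [pred t | `[<B (u k t)>]] = pr R [pred t | `[<B (- u k t)>]].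
Proof.
rewrite /pr; congr (_%:R / _).
pose h (t : T) : T := (~~ t.1, t.2).
have hK : involutive h by case=> b i; rewrite /h /= negbK.
rewrite -!sum1_card (reindex h (onW_bij _ (inv_bij hK))).
apply: eq_bigl => -[b i]; rewrite !inE /u /=; case: ifP => _; last by rewrite oppr0.
by rewrite signrN mulNr.
Qed.

(** The sample space is exposed through the support events, their probabilities and those of
    pairwise intersections, which is all that the tail estimates use. *)
Lemma three_valued_family :
  exists (Omega : finType) (w0 : Omega) (X : R -> Omega) (E : 'I_N -> pred Omega)
    (f : 'I_N -> R -> R),
  [/\ forall P : pred Omega,
        measurable (`[0, 1] `&` [set s | P (X s)] : set (lebesgueType R)) /\
        m01 [set s | P (X s)] = (pr R P)%:E,
      forall k, pr R (E k) = (m k)%:R / Q%:R,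
      forall i j, i != j -> pr R [pred w | E i w && E j w] =
        ((m i)%:R / Q%:R) * ((m j)%:R / Q%:R),
      forall k s, `|f k s| = (((m k)%:R / Q%:R) `^ p^-1)^-1 * (E k (X s))%:R &
      [/\ forall c : 'I_N -> R, lorentz_space p q (fun s => \sum_j c j * f j s),
          forall k, symmetrically_distributed (f k),
          mutually_independent f &
          forall k, lorentz_norm p q (f k) = 1%E]].
Proof.
pose Omega : finType := {ffun 'I_N -> T}; pose w0 : Omega := [ffun=> t0].
have [X XP] := uniform_map R w0.
have XP2 P := (XP P).2.
pose f k s := u k (X s k).
exists Omega, w0, X, (fun k (w : {ffun 'I_N -> T}) => (w k).2 < m k)%N, f; split=> //.
- by move=> k; rewrite -[RHS]pr_support -(pr_coord _ t0 k).
- by move=> i j ij; rewrite (pr_coord2 _ t0 [pred t : T | (t.2 < m i)%N]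
    [pred t : T | (t.2 < m j)%N] ij) !pr_support.
- by move=> k s; rewrite normu.
split.
- move=> c; exact: (lorentz_space_pullback w0 hp hq XP (fun w => \sum_j c j * u j (w j))).
- move=> k B mB.
  rewrite (m01_pullback XP (P := [pred w : Omega | [pred t | `[<B (u k t)>]] (w k)])); last first.
    by move=> s /=; split=> /asboolP.
  rewrite (m01_pullback XP (P := [pred w : Omega | [pred t | `[<B (- u k t)>]] (w k)])); last first.
    by move=> s /=; split=> /asboolP.
  by rewrite !(pr_coord _ t0) pr_neg.
- exact: independent_coords XP2.
move=> k; have /andP[mu0 mu1] := mu01 k.
have amu : a k * mu k `^ p^-1 = 1 by rewrite mulVf // gt_eqF // powR_gt0.
have m01a (A : set R) : (forall s, A s <-> ((X s k).2 < m k)%N) -> m01 A = (mu k)%:E.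
  move=> As; rewrite (m01_pullback XP (P := [pred w : Omega | (w k).2 < m k]%N) As) -pr_support.
  by rewrite -(pr_coord _ t0 k).
have fa : m01 [set s | a k < `|f k s|] = 0%E.
  rewrite (m01_pullback XP (P := pred0)) => [|s]; first by rewrite pr_pred0.
  split=> //=; rewrite normu ltNge; case: (_ < _)%N; rewrite ?mulr1 ?lexx // mulr0.
  by rewrite ltW.
have fpos tau : 0 <= tau -> tau < a k -> m01 [set s | tau < `|f k s|] = (mu k)%:E.
  move=> tau0 taua; apply: m01a => s /=; rewrite normu; case: (_ < _)%N; rewrite ?mulr1 //.
  by rewrite mulr0 ltNge tau0.
(* The rearrangement is a_k on (0, mu_k] and 0 beyond, so both bounds equal a_k mu_k^(1/p) = 1. *)
apply/eqP; rewrite eq_le; apply/andP; split; last first.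
  rewrite -[leLHS]/((1 : R)%:E) -amu.
  apply: (@lorentz_norm_ge _ _ _ hp hq _ _ (a k)) => //; rewrite ?mu0 // 1?ltW //.
  by move=> tau tau0 taua; rewrite fpos.
have -> : 1%E = (1%:R `^ einv q * 1)%:E :> \bar R by rewrite powR1 mulr1.
apply: (@lorentz_norm_le _ _ _ hp hq _ 1 (fun j => if j is 0 then 0 else a k)
  (fun=> mu k)) => //.
- by case=> // _; rewrite ltW.
- by move=> _; rewrite ltW.
- by case=> // _; rewrite fpos.
- by case=> // j _; rewrite amu.
Qed.

End three_valued.

(** * Tail estimates for the two choices of supports *)

Lemma spread_family_of_tail (R : realType) (p : R) (q : \bar R) (N Q : nat)
    (m : 'I_N -> nat) (L : nat) (b c : nat -> R) (D : R) :
  0 < p -> (0 < q)%E -> (0 < Q)%N -> (forall k, (0 < m k <= Q)%N) -> (0 < L)%N ->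
  b 0%N = 0 -> (forall j, 0 <= b j) -> (forall j, 0 <= c j <= 1) ->
  (forall j, (0 < j <= L)%N -> b j * c j `^ p^-1 <= D) ->
  (forall (Omega : finType) (E : 'I_N -> pred Omega) (S : Omega -> R),
    (forall k, pr R (E k) = (m k)%:R / Q%:R) ->
    (forall i j, i != j -> pr R [pred w | E i w && E j w] =
        ((m i)%:R / Q%:R) * ((m j)%:R / Q%:R)) ->
    (forall w, S w = \sum_k (((m k)%:R / Q%:R) `^ p^-1)^-1 * (E k w)%:R) ->
    (forall w, S w <= b L) /\
    (forall j, (j < L)%N -> pr R [pred w | b j < S w] <= c j.+1)) ->
  exists f : 'I_N -> R -> R, spread_family p q f (L%:R `^ einv q * D).
Proof.
move=> hp hq Q0 mQ L0 b0 bge c01 bcD tail.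
have [Om [w0 [X [E [f [XP prE prE2 fE [fL fs fi f1]]]]]]] :=
  three_valued_family hp hq Q0 mQ.
pose S w := \sum_k (((m k)%:R / Q%:R) `^ p^-1)^-1 * (E k w)%:R.
have [SL Sc] := tail Om E S prE prE2 (fun=> erefl).
exists f; split=> // eps g eps0 gf.
have gS s : `|g s| <= eps * S (X s).
  by apply: le_trans (gf s) _; rewrite /S; under eq_bigr do rewrite fE.
exact: (lorentz_norm_tail hp hq XP L0 b0 bge c01 SL Sc bcD eps0 gS).
Qed.

(** All mu_k equal a tiny mu, so S is [a] times the number of supports hit. A double hit is so
    improbable that even the largest value N a contributes no more than single hits do, namely a (N
    mu)^(1/p) = N^(1/p). *)
Lemma spread_family_large_p (R : realType) (p : R) (q : \bar R) (N : nat) :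
  0 < p -> (0 < q)%E -> (0 < N)%N ->
  exists f : 'I_N -> R -> R, spread_family p q f (2 `^ einv q * N%:R `^ p^-1).
Proof.
move=> hp hq N0.
have N1 : (1 : R) <= N%:R by rewrite ler1n.
have NR : (0 : R) < N%:R by rewrite ltr0n.
(* Since K + 2 > p + 1, N mu <= N^(- p); hence (N mu)^(1/p) <= 1 / N offsets the factor N of the top
   level. *)
pose K := Num.trunc p; pose Q := (N ^ K.+2)%N.
have Q0 : (0 < Q)%N by rewrite expn_gt0 N0.
have QR : (0 : R) < Q%:R by rewrite ltr0n.
pose mu : R := 1%:R / Q%:R; pose a : R := (mu `^ p^-1)^-1.
have mu0 : 0 < mu by rewrite divr_gt0.
have a0 : 0 < a by rewrite invr_gt0 powR_gt0.
have amu : a * mu `^ p^-1 = 1 by rewrite mulVf // gt_eqF // powR_gt0.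
have Nmu : N%:R * mu = (N%:R ^+ K.+1)^-1.
  by rewrite /mu /Q mul1r natrX exprS invfM mulrA divff ?gt_eqF // mul1r.
have Nmu0 : 0 <= N%:R * mu by rewrite mulr_ge0 // ltW.
have Nmu1 : N%:R * mu <= 1 by rewrite Nmu invf_le1 ?exprn_gt0 // exprn_ege1.
have Nmup : (N%:R * mu) `^ p^-1 <= N%:R^-1.
  have -> : N%:R^-1 = (N%:R `^ (- p)) `^ p^-1 :> R.
    by rewrite -powRrM mulNr divff ?gt_eqF // powR_inv1.
  apply: ge0_ler_powR; rewrite ?nnegrE ?invr_ge0 ?powR_ge0 ?(ltW hp) //.
  rewrite Nmu -powR_invn ?(ltW NR) //; apply: ler_powR => //.
  by rewrite lerN2 ltW // truncnS_gt.
(* S > 0 needs one hit, of probability at most N mu; S > a needs two, of probability at most (N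
   mu)^2 by the union bound over pairs. *)
pose b (j : nat) : R := if j is 0 then 0 else if j is 1 then a else N%:R * a.
pose c (j : nat) : R := if j is 1 then N%:R * mu else (N%:R * mu) ^+ 2.
apply: (@spread_family_of_tail R p q N Q (fun=> 1%N) 2 b c) => //.
- by rewrite /b => -[|[|?]]; rewrite ?mulr_ge0 ?(ltW a0).
- by move=> j; rewrite /c; case: j => [|[|?]]; rewrite ?Nmu0 ?Nmu1 // exprn_ge0 //= exprn_ile1.
- have ac : a * (N%:R * mu) `^ p^-1 = N%:R `^ p^-1.
    by rewrite powRM ?(ltW mu0) // mulrCA amu mulr1.
  move=> j; rewrite /b /c; case: j => [|[|[|?]]] //= _; first by rewrite ac.
  rewrite expr2 powRM // -mulrA mulrA [N%:R * _]mulrC mulrA.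
  rewrite -[leRHS]mulr1 -ac -!mulrA ler_pM2l //.
  rewrite mulrCA [in leRHS]mulr1 -[leRHS]mulr1 ler_wpM2l ?powR_ge0 //.
  by rewrite -ler_pdivlMl // mulr1.
move=> Omega E S prE prE2 SE; rewrite -/mu in prE prE2 SE.
have Sa w : S w = a * \sum_k (E k w)%:R by rewrite SE mulr_sumr.
split=> [w|[|[|//]] _ /=].
- rewrite Sa /b mulrC ler_pM2r //.
  apply: le_trans (ler_sum (G := fun=> 1) _ _) _; last by rewrite sumr_const card_ord.
  by move=> k _; case: (E k w).
- apply: le_trans (@pr_exists R _ _ predT E _ _) _.
    move=> w /=; rewrite Sa pmulr_rgt0 // => h.
    have [i Ei|h0] := pickP (fun i => E i w); first by exists i.
    by move: h; rewrite big1 ?ltxx // => k _; rewrite h0.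
  by under eq_bigr do rewrite prE; rewrite sumr_const card_ord mulr_natl.
apply: le_trans (@pr_exists R _ _ [pred z : 'I_N * 'I_N | z.1 != z.2]
  (fun z => [pred w | E z.1 w && E z.2 w]) _ _) _.
  move=> w /=; rewrite Sa -[ltLHS]mulr1 ltr_pM2l // => h.
  have [i Ei|h0] := pickP (fun i => E i w); last first.
    by move: h; rewrite big1 ?ltr10 // => k _; rewrite h0.
  have [j /andP[ij Ej]|h1] := pickP (fun j => (i != j) && E j w).
    by exists (i, j) => //=; rewrite Ei.
  move: h; rewrite (bigD1 i) //= Ei big1 ?addr0 ?ltxx // => k ki.
  by have := h1 k; rewrite eq_sym ki /= => ->.
rewrite (eq_bigr (fun=> mu * mu)); last by move=> [i j] /= ij; exact: prE2.
rewrite (sumr_const [pred z : 'I_N * 'I_N | z.1 != z.2]) -[leLHS]mulr_natl.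
rewrite -[mu * mu]expr2 [in leRHS]exprMn.
rewrite ler_wpM2r ?exprn_ge0 ?(ltW mu0) //.
rewrite -natrX ler_nat -mulnn; apply: leq_trans (max_card _) _.
by rewrite card_prod card_ord.
Qed.

(** The bound serves as the n-th level of a tail estimate, and levels start at 0; hence the separate
    value at n = 0. *)
Lemma sum_geometric_le (R : realType) (A : R) (n : nat) : 2 <= A ->
  \sum_(i < n) A ^+ i.+1 <= if n is 0 then 0 else 2 * A ^+ n.
Proof.
move=> A2; elim: n => [|n IH]; first by rewrite big_ord0.
have A0 k : 0 <= A ^+ k by rewrite exprn_ge0 // (le_trans _ A2).
have An : 2 * A ^+ n <= A ^+ n.+1 by rewrite exprS ler_wpM2r.
rewrite big_ord_recr /=; apply: (@le_trans _ _ (2 * A ^+ n + A ^+ n.+1)).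
  rewrite lerD2r; apply: le_trans IH _.
  by case: n An => // _; rewrite expr0; lra.
lra.
Qed.

Lemma sum_geometric_tail_le (R : realType) (B : R) (j n : nat) : 0 <= B <= 2^-1 ->
  \sum_(i < n | (j <= i)%N) B ^+ i.+1 <= 2 * B ^+ j.+1.
Proof.
move=> /andP[B0 B2].
have Bn k : 0 <= B ^+ k by rewrite exprn_ge0.
(* Strengthened for the induction by subtracting a remainder; [maxn] covers n <= j, where the sum is
   empty. *)
suff : \sum_(i < n | (j <= i)%N) B ^+ i.+1 <= 2 * B ^+ j.+1 - 2 * B ^+ (maxn j n).+1.
  by move/le_trans; apply; rewrite gerBl mulr_ge0.
elim: n => [|n IH]; first by rewrite big_ord0 maxn0 subrr.
rewrite big_mkcond big_ord_recr -big_mkcond /=.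
have [jn|nj] := leqP j n; last first.
  move: IH; rewrite (maxn_idPl nj) (maxn_idPl (ltnW nj)) addr0.
  by apply: le_trans; rewrite lexx.
move: IH; rewrite (maxn_idPr jn) (maxn_idPr (leqW jn)) => IH.
have : 2 * B ^+ n.+2 <= B ^+ n.+1.
  rewrite (exprS _ n.+1) mulrA -[leRHS]mul1r ler_wpM2r //; lra.
by move: IH; lra.
Qed.

(** Heights grow as A^(k + 1) while probabilities decay as B^(k + 1), with A = M^(1/p) and B = 1 /
    M. Exceeding 2 A^j requires some E_k with k >= j, of total probability at most 2 B^(j + 1), so
    each of the N levels contributes the same amount 2 2^(1/p). *)
Lemma spread_family_large_q (R : realType) (p : R) (q : \bar R) (N : nat) :
  0 < p -> (0 < q)%E -> (0 < N)%N ->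
  exists f : 'I_N -> R -> R, spread_family p q f (N%:R `^ einv q * (2 * 2 `^ p^-1)).
Proof.
move=> hp hq N0.
(* M > 2^p gives A >= 2 and M >= 2 gives B <= 1/2, as the two geometric sums require. *)
pose M := (Num.trunc (2 `^ p : R)).+2.
have M2 : (2 : R) <= M%:R by rewrite ler_nat.
have M0 : (0 : R) < M%:R by rewrite ltr0n.
pose A : R := M%:R `^ p^-1.
have A2 : 2 <= A.
  have -> : (2 : R) = (2 `^ p) `^ p^-1 by rewrite -powRrM divff ?gt_eqF // powRr1.
  apply: ge0_ler_powR; rewrite ?nnegrE ?invr_ge0 ?powR_ge0 ?(ltW hp) //.
  by rewrite ltW // (lt_trans (truncnS_gt _)) // ltr_nat.
have A0 : 0 <= A by exact: powR_ge0.
pose B : R := M%:R^-1.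
have B01 : 0 <= B <= 2^-1 by rewrite invr_ge0 ltW //= lef_pV2 ?posrE.
have mE (k : 'I_N) : (M ^ (N - k.+1))%N%:R / (M ^ N)%N%:R = B ^+ k.+1 :> R.
  have -> : (M ^ N = M ^ k.+1 * M ^ (N - k.+1))%N by rewrite -expnD subnKC.
  rewrite natrM invfM mulrCA divff ?mulr1; first by rewrite natrX /B exprVn.
  by rewrite natrX expf_neq0 // gt_eqF.
have BA n : (B ^+ n) `^ p^-1 = (A ^+ n)^-1.
  by rewrite /B /A exprVn -powR_invn ?(ltW M0) // powRAC powR_invn.
pose b (j : nat) : R := if j is 0 then 0 else 2 * A ^+ j.
pose c (j : nat) : R := if j is 0 then 0 else 2 * B ^+ j.
apply: (@spread_family_of_tail R p q N (M ^ N) (fun k => M ^ (N - k.+1))%N N b c) => //.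
- by rewrite expn_gt0.
- by move=> k; rewrite expn_gt0 leq_exp2l //= leq_subr.
- by move=> j; rewrite /b; case: j => // ?; rewrite mulr_ge0 // exprn_ge0.
- case/andP: B01 => B0 B2 j; rewrite /c; case: j => [|j] /=; first by rewrite lexx ler01.
  rewrite mulr_ge0 ?exprn_ge0 //= exprS mulrA.
  apply: mulr_ile1; rewrite ?mulr_ge0 ?exprn_ge0 //; first by lra.
  by apply: exprn_ile1 => //; lra.
- move=> j; rewrite /b /c; case: j => // j _; case/andP: B01 => B0 _.
  rewrite powRM ?exprn_ge0 // BA.
  rewrite mulrACA divff ?mulr1 // expf_neq0 // gt_eqF // (lt_le_trans _ A2) //.
move=> Omega E S prE _ SE.
have {}SE w : S w = \sum_(k < N) A ^+ k.+1 * (E k w)%:R.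
  by rewrite SE; apply: eq_bigr => k _; rewrite mE BA invrK.
have Sle j w : (j <= N)%N -> (forall k : 'I_N, (j <= k)%N -> ~~ E k w) -> S w <= b j.
  move=> jN h; apply: le_trans (sum_geometric_le j A2).
  rewrite SE (big_ord_widen_cond N xpredT (fun k => A ^+ k.+1)) //= [leRHS]big_mkcond.
  apply: ler_sum => k _; have [kj|jk] := ltnP k j.
    by rewrite -[leRHS]mulr1 ler_wpM2l ?exprn_ge0 //; case: (E k w).
  by rewrite (negbTE (h k jk)) mulr0.
split=> [w|j jN].
  by apply: Sle => // k; rewrite leqNgt ltn_ord.
apply: le_trans (@pr_exists R _ _ (fun k : 'I_N => (j <= k)%N) E _ _) _.
  move=> w /= h; have [k /andP[jk Ek]|h0] := pickP (fun k : 'I_N => (j <= k)%N && E k w).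
    by exists k.
  move: h; rewrite ltNge Sle // ?(ltnW jN) // => k jk.
  by have := h0 k; rewrite jk /= => ->.
under eq_bigr do rewrite prE mE.
exact: sum_geometric_tail_le.
Qed.

Unset Implicit Arguments.

Theorem corollary3p12 (R : realType) (p : R) (q : \bar R)
    (hp : 0 < p) (hq : (0 < q)%E) (hpq : (2%:E < maxe p%:E q)%E) :
  exists delta C : R, 0 < delta /\
    forall N : nat, (0 < N)%N ->
      exists f : 'I_N -> R -> R,
        [/\ forall k, lorentz_space p q (f k),
            forall k, symmetrically_distributed (f k),
            mutually_independent f,
            forall k, lorentz_norm p q (f k) = 1%E &
            forall n : nat, N%:R `^ (1 - delta) <= n%:R ->
              (kolmogorov_width (lorentz_norm p q) (lorentz_space p q)
                 (range f) n <= (C * N%:R `^ (- delta))%:E)%E].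
Proof.
(* For q > 2 the exponent theta = 1/q (0 at q = oo) is below 1/2; otherwise the hypothesis forces p
   > 2 and theta = 1/p works. *)
have [q2|q2] := boolP (2%:E < q)%E.
  apply: (@width_of_spread_families _ p q (einv q) (2 * 2 `^ p^-1)) => //.
  - case: q hq q2 {hpq} => [r _|_ _|//] /=; last by rewrite lexx invr_gt0 ltr0n.
    rewrite lte_fin => r2; have r0 : 0 < r by rewrite (lt_trans _ r2).
    by rewrite invr_ge0 (ltW r0) ltf_pV2 ?posrE.
  - by move=> N N0; rewrite [2 * _ * _]mulrC; exact: spread_family_large_q.
have p2 : 2 < p by move: hpq; rewrite lt_max (negbTE q2) orbF lte_fin.
apply: (@width_of_spread_families _ p q p^-1 (2 `^ einv q)) => //.
- by rewrite invr_ge0 (ltW hp) ltf_pV2 ?posrE.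
- by move=> N N0; exact: spread_family_large_p.
Qed.
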